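(* Let $d\in\mathbb{N}$. For each $s\in\mathbb{N}$, let $\chi_d(s)$ be the number of points $(m,n)\in\mathbb{Z}^2$ for which the conditions $$(m,n)=\sum_{k=1}^s\big(f(-i_k),\,f(-i_k-1)\big)\quad\text{and}\quad \sum_{k=1}^s f(i_k)\le d$$ admit a solution in integers $0\le i_1\le\dots\le i_s$, and $s$ is maximal with this property (i.e. no solution exists with a larger number of terms). Then $$\chi_d(s)=\begin{cases}2s+1 & \text{if } 0\le s<d,\\ d+1 & \text{if } s=d,\\ 0 & \text{if } s>d.\end{cases}$$ Equivalently: for every $s\in\mathbb{N}$, the set $E_d(s)=\{\alpha\in E_d:\ s_d(\alpha)=s\}$ is empty for $s>d$, has $2s+1$ elements for $0\le s<d$, and has $d+1$ elements for $s=d$.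
   Context: $\mathbb{N}=\{0,1,2,\dots\}$. Let $f\colon\mathbb{Z}\to\mathbb{Z}$ be defined by $f(0)=f(1)=1$ and $f(i+2)=f(i+1)+f(i)$ for all $i\in\mathbb{Z}$ (so $(f(i))_{i\ge0}$ is the Fibonacci sequence, and e.g. $f(-1)=0$, $f(-2)=1$). An empty sum is $0$ (so $(m,n)=(0,0)$ satisfies the conditions with $s=0$). Let $\gamma=(1+\sqrt5)/2$ and $\mathbb{Z}[\gamma]=\mathbb{Z}\oplus\mathbb{Z}\gamma^{-1}$; one has $\gamma^{-i}=f(-i)+f(-i-1)\gamma^{-1}$ for $i\in\mathbb{Z}$. For $d\in\mathbb{N}$, $E_d$ denotes the set of $\alpha\in\mathbb{Z}[\gamma]$ such that $\alpha=\gamma^{-i_1}+\dots+\gamma^{-i_s}$ and $f(i_1)+\dots+f(i_s)\le d$ for some $s\in\mathbb{N}$ and integers $0\le i_1\le\dots\le i_s$; for $\alpha\in E_d$, $s_d(\alpha)$ is the largest such $s$. *)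

(* Defs.v *)
From HB Require Import structures.
From mathcomp Require Import all_boot all_order all_algebra.
Set Implicit Arguments. Unset Strict Implicit. Unset Printing Implicit Defensive.
Import Order.TTheory GRing.Theory Num.Theory.

Fixpoint fibn (n : nat) : nat :=
  match n with
  | 0 => 1
  | 1 => 1
  | (m.+1 as k).+1 => fibn k + fibn m
  end.

(* fneg n = f(-n): from f(i+2) = f(i+1) + f(i) we get f(-n-2) = f(-n) - f(-n-1). *)
Fixpoint fneg (n : nat) : int :=
  match n with
  | 0 => 1%R
  | 1 => 0%R
  | (m.+1 as k).+1 => (fneg m - fneg k)%R
  end.

(* f : Z -> Z, the two-sided Fibonacci sequence; Negz n = -(n+1). *)
Definition f (i : int) : int :=
  match i with
  | Posz n => (fibn n)%:Z
  | Negz n => fneg n.+1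
  end.

Lemma f_sanity :
  [/\ f 0%R = 1%R, f 1%R = 1%R, f 5%R = 8%R, f (-1)%R = 0%R
    & f (-2)%R = 1%R /\ f (-5)%R = (-3)%R].
Proof. by split; try split; reflexivity. Qed.

Local Open Scope ring_scope.

Definition solvable (d : nat) (p : int * int) (s : nat) : Prop :=
  exists js : seq nat,
    [/\ size js = s,
        sorted leq js,
        p = (\sum_(i <- js) f (- (i%:Z)), \sum_(i <- js) f (- (i%:Z) - 1))
      & \sum_(i <- js) f (i%:Z) <= d%:Z].

Definition maximal_rep (d : nat) (p : int * int) (s : nat) : Prop :=
  solvable d p s /\ (forall s', solvable d p s' -> (s' <= s)%N).

Definition chi_value (d s : nat) : nat :=
  if (s < d)%N then (2 * s + 1)%N
  else if s == d then d.+1 else 0%N.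

(* Main.v *)
(**
  Trade terms of a representation by gamma^-i = gamma^-(i+1) + gamma^-(i+2),
  which adds a term and raises the cost by 2 f(i+1). Exchanging i, i+3 for
  i+1, i+1 keeps the number of terms and lowers the cost, and two indices at
  distance at least 4 can be replaced by three or more indices at no extra cost.
  So a longest representation of cost at most d can be taken in a window
  i, i+1, i+2, with i occurring. Such a representation with s terms is unique,
  and by linear programming duality any longer one costs at least 2 f(i+1) more.
  Hence E_d(s) is in bijection with the windows x with s terms such that
  cost x <= d < cost x + 2 f(i+1).

  An injection "raise" of the set of windows with s terms into itself increases
  the cost by exactly 2 f(i+1), and its image misses exactly 2s+1 windows, all of
  cost at most s+1. For s < d each of its 2s+1 orbits thus contributes one point
  to E_d(s). For s = d all indices are 0 or 1.
*)
Require Import Defs.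
From HB Require Import structures.
From mathcomp Require Import all_boot all_order all_algebra.
From mathcomp Require Import zify ring.
Set Implicit Arguments. Unset Strict Implicit. Unset Printing Implicit Defensive.
Import Order.TTheory GRing.Theory Num.Theory.

(** * Fibonacci numbers with indices of both signs *)

Lemma fibn_rec n : fibn n.+2 = fibn n.+1 + fibn n.
Proof. by []. Qed.

Lemma fneg_rec n : fneg n.+2 = (fneg n - fneg n.+1)%R.
Proof. by []. Qed.

Lemma fibn_gt0 n : 0 < fibn n.
Proof.
suff: 0 < fibn n /\ 0 < fibn n.+1 by case.
by elim: n => // n [h1 h2]; rewrite fibn_rec; lia.
Qed.

Lemma leq_fibn m n : m <= n -> fibn m <= fibn n.
Proof.
elim: n => [|n IHn]; first by rewrite leqn0 => /eqP->.
rewrite leq_eqVlt => /orP[/eqP-> //|]; rewrite ltnS => /IHn h.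
by apply: leq_trans h _; case: n {IHn} => // n; rewrite fibn_rec leq_addr.
Qed.

Lemma fibn_eq1 n : fibn n = 1 -> n < 2.
Proof.
case: n => [|[|n]] //; rewrite fibn_rec.
by have := fibn_gt0 n; have := fibn_gt0 n.+1; lia.
Qed.

Lemma f_nneg (n : nat) : f n = Posz (fibn n). Proof. by []. Qed.

Lemma f_neg (n : nat) : f (- (n%:Z))%R = fneg n.
Proof. by case: n. Qed.

Lemma f_neg1 (n : nat) : f (- (n%:Z) - 1)%R = fneg n.+1.
Proof. by rewrite -f_neg; congr f; lia. Qed.

Lemma f_rec (z : int) : (f (z + 2) = f (z + 1) + f z)%R.
Proof.
case: z => [n|[|[|n]]] //.
  have -> : (n%:Z + 2 = n.+2%:Z)%R by lia.
  have -> : (n%:Z + 1 = n.+1%:Z)%R by lia.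
  by rewrite !f_nneg fibn_rec PoszD.
have -> : (Negz n.+2 + 2 = - (n.+1%:Z))%R by lia.
have -> : (Negz n.+2 + 1 = - (n.+2%:Z))%R by lia.
have -> : (Negz n.+2 = - (n.+3%:Z))%R by lia.
by rewrite !f_neg (fneg_rec n.+1); lia.
Qed.

(** * Representations as unordered lists of exponents *)

Definition value (js : seq nat) : int * int :=
  (\sum_(i <- js) fneg i, \sum_(i <- js) fneg i.+1)%R.

Definition cost (js : seq nat) : nat := \sum_(i <- js) fibn i.

(** Both sums are symmetric in the exponents, so sorting restores the order condition, which can be
    forgotten from here on. *)
Lemma solvableP d p s :
  solvable d p s <-> exists js, [/\ size js = s, p = value js & cost js <= d].
Proof.
have cE js : (\sum_(i <- js) f i%:Z)%R = cost js.
  by rewrite -[in RHS]natz /cost natr_sum; apply: eq_bigr => i _; rewrite natz.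
have vE js : (\sum_(i <- js) f (- i%:Z), \sum_(i <- js) f (- i%:Z - 1))%R
    = value js.
  by congr pair; apply: eq_bigr => i _; rewrite (f_neg, f_neg1).
split=> [[js [h1 _ h2 h3]]|[js [h1 h2 h3]]].
  by exists js; split; rewrite // -?vE // -lez_nat -cE.
have pjs : perm_eq (sort leq js) js by rewrite perm_sort.
exists (sort leq js); split.
- by rewrite size_sort.
- by apply: sort_sorted; apply: leq_total.
- by rewrite vE h2 /value !(perm_big _ pjs).
- by rewrite cE /cost (perm_big _ pjs) lez_nat.
Qed.

(** * Linear functionals of the value *)

(* The recurrence of k |-> gamma^-k: the sum of such a [w] over a multiset
   depends on the value of the multiset only. *)
Definition antifib (w : nat -> int) := forall k, (w k = w k.+1 + w k.+2)%R.

Lemma antifibE w : antifib w ->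
  forall k, (w k = w 0 * fneg k + w 1 * fneg k.+1)%R.
Proof.
move=> hw k; suff: (w k = w 0 * fneg k + w 1 * fneg k.+1 /\
   w k.+1 = w 0 * fneg k.+1 + w 1 * fneg k.+2)%R by case.
elim: k => [|k [h1 h2]]; first by split; rewrite /=; ring.
split=> //; have -> : (w k.+2 = w k - w k.+1)%R by rewrite (hw k); ring.
by rewrite h1 h2 (fneg_rec k.+1) (fneg_rec k); ring.
Qed.

Lemma sum_antifib w js js' : antifib w -> value js = value js' ->
  (\sum_(k <- js) w k = \sum_(k <- js') w k)%R.
Proof.
move=> hw [e1 e2].
have E r : (\sum_(k <- r) w k =
    w 0 * \sum_(k <- r) fneg k + w 1 * \sum_(k <- r) fneg k.+1)%R.
  rewrite !mulr_sumr -big_split; apply: eq_bigr => k _; exact: antifibE.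
by rewrite !E e1 e2.
Qed.

Lemma antifib_f (z : int) : antifib (fun k => f (z - k%:Z)%R).
Proof.
move=> k; have := f_rec (z - k.+2%:Z)%R.
have -> : (z - k.+2%:Z + 2 = z - k%:Z)%R by lia.
by have -> : (z - k.+2%:Z + 1 = z - k.+1%:Z)%R by lia.
Qed.

Lemma f_sub_nneg (m n : nat) : n <= m -> f (m%:Z - n%:Z)%R = fibn (m - n).
Proof. by move=> h; rewrite subzn. Qed.

(** The functional [f (m - k)], with [m] the largest entry, is at least 1 at every entry, so its sum
    over a nonempty list is positive. *)
Lemma value_neq0 js : js != [::] -> value js <> value [::].
Proof.
move=> njs e; have := sum_antifib (antifib_f (\max_(k <- js) k)) e.
rewrite big_nil => e0; suff: (0 < \sum_(k <- js) f ((\max_(k <- js) k)%:Z - k%:Z))%R.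
  by rewrite e0.
have h k : k \in js -> (1 <= f ((\max_(k <- js) k)%:Z - k%:Z))%R.
  move=> hk; rewrite f_sub_nneg ?lez_nat ?fibn_gt0 //.
  exact: leq_bigmax_seq.
case: js njs {e e0} h => // j js _; move: (\max_(_ <- _) _) => m h.
rewrite big_cons ltr_pwDl //; first by have := h j (mem_head _ _); lia.
rewrite big_seq; apply: sumr_ge0 => k kj.
by have := h k; rewrite in_cons kj orbT => /(_ isT); lia.
Qed.

(** * Windows and their uniqueness for a given size *)

Definition window (x : nat * nat * nat * nat) : seq nat :=
  let: (i, A, B, C) := x in nseq A i ++ nseq B i.+1 ++ nseq C i.+2.

(** The condition [0 < A] makes [i] the least entry, so that a multiset is encoded by at most one
    quadruple. *)
Definition windowed (s : nat) (x : nat * nat * nat * nat) : bool :=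
  let: (i, A, B, C) := x in (0 < A) && (A + B + C == s).

Definition level (x : nat * nat * nat * nat) : nat := x.1.1.1.

Lemma size_window s x : windowed s x -> size (window x) = s.
Proof.
by case: x => [[[i A] B] C] /andP[_ /eqP<-] /=; rewrite !size_cat !size_nseq addnA.
Qed.

Lemma sum_nseq (w : nat -> int) n k :
  (\sum_(l <- nseq n k) w l = w k * n%:Z)%R.
Proof. by rewrite big_nseq iter_addr_0 -mulr_natr natz. Qed.

Lemma sum_window (w : nat -> int) i A B C :
  (\sum_(k <- window (i, A, B, C)) w k =
    w i * A%:Z + w i.+1 * B%:Z + w i.+2 * C%:Z)%R.
Proof. by rewrite /window 2!big_cat 3!sum_nseq /= addrA. Qed.

Lemma cost_window i A B C :
  cost (window (i, A, B, C)) =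
    fibn i * A + fibn i.+1 * B + fibn i.+2 * C.
Proof. by rewrite /cost 2!big_cat 3!big_nseq 3!iter_addn_0 /= addnA. Qed.

(* [f (j + 1 - k)] is the sum of the two coordinates of gamma^-k in the basis
   gamma^-j, gamma^-(j+1): this sum is at most [s] for the second window, and
   exceeds [s] for the first. *)
Lemma value_window_level s x y : windowed s x -> windowed s y ->
  value (window x) = value (window y) -> level y <= level x.
Proof.
case: x y => [[[i A] B] C] [[[j A'] B'] C'] /=.
move=> /andP[A_gt0 /eqP es] /andP[_ /eqP es'].
rewrite /level /= => /(sum_antifib (antifib_f j.+1)); rewrite !sum_window.
case: leqP => // lt_ij.
have -> : (j.+1%:Z - j%:Z = 1%:Z)%R by lia.
have -> : (j.+1%:Z - j.+1%:Z = 0%:Z)%R by lia.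
have -> : (j.+1%:Z - j.+2%:Z = -1)%R by lia.
rewrite !f_sub_nneg; try lia.
rewrite /= subSn 1?ltnW // (_ : j.+1 - i.+1 = (j - i.+1).+1); last by lia.
rewrite (_ : j.+1 - i.+2 = j - i.+1); last by lia.
rewrite (_ : j - i = (j - i.+1).+1); last by lia.
rewrite fibn_rec.
have q_gt0 := fibn_gt0 (j - i.+1); have p_gt0 := fibn_gt0 (j - i.+1).+1.
move: (fibn (j - i.+1)) (fibn _.+1) q_gt0 p_gt0 => q p q_gt0 p_gt0 e.
have hA : A.+1 <= (p + q) * A by rewrite mulnDl -add1n leq_add // ?leq_pmull ?muln_gt0 ?p_gt0.
have hB : B <= p * B by rewrite leq_pmull.
have hC : C <= q * C by rewrite leq_pmull.
lia.
Qed.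

(** Comparing in both directions, the levels agree. The functionals [f (i - k)] and [f (i + 1 - k)]
    then read off A + C and A + B, which together with A + B + C = s determine the
    multiplicities. *)
Lemma value_window_inj s x y : windowed s x -> windowed s y ->
  value (window x) = value (window y) -> x = y.
Proof.
move=> wx wy e; have := value_window_level wx wy e.
have := value_window_level wy wx (esym e).
case: x y wx wy e => [[[i A] B] C] [[[j A'] B'] C'] /=.
move=> /andP[_ /eqP es] /andP[_ /eqP es'] e; rewrite /level /= => h1 h2.
have eij : j = i by lia.
subst j; have := sum_antifib (antifib_f i) e.
rewrite !sum_window.
have -> : (i%:Z - i%:Z = 0%:Z)%R by lia.
have -> : (i%:Z - i.+1%:Z = -1)%R by lia.
have -> : (i%:Z - i.+2%:Z = -2)%R by lia.
rewrite /= => e1.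
have := sum_antifib (antifib_f i.+1) e; rewrite !sum_window.
have -> : (i.+1%:Z - i%:Z = 1%:Z)%R by lia.
have -> : (i.+1%:Z - i.+1%:Z = 0%:Z)%R by lia.
have -> : (i.+1%:Z - i.+2%:Z = -1)%R by lia.
by rewrite /= => e2; congr (_, _, _, _); lia.
Qed.

(** * Cost lower bound by linear programming duality *)

(* The linear functional that agrees with [f j - 2 f(i+1)] at
   [j = i, i+1, i+2]. *)
Definition dual (i k : nat) : int :=
  ((fibn i)%:Z * f (i%:Z - k%:Z) - (fibn i.+1)%:Z * f (i.+2%:Z - k%:Z))%R.

Lemma antifib_dual i : antifib (dual i).
Proof.
move=> k; rewrite /dual (antifib_f i k) (antifib_f i.+2 k); ring.
Qed.

Lemma dualD i k :
  (dual i (i + k) = (fibn i)%:Z * fneg k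
     - (fibn i.+1)%:Z * (fneg k + fneg k + fneg k.+1))%R.
Proof.
rewrite /dual (_ : i%:Z - (i + k)%:Z = - k%:Z)%R; last by lia.
rewrite (_ : i.+2%:Z - (i + k)%:Z = - k%:Z + 2)%R; last by lia.
rewrite f_rec f_neg; have := f_rec (- k%:Z - 1); rewrite f_neg1.
rewrite (_ : - k%:Z - 1 + 2 = - k%:Z + 1)%R; last by lia.
by rewrite subrK f_neg => ->; congr (_ - _ * _)%R; lia.
Qed.

(** The recurrence expresses each value as a difference of the two preceding ones, so by the
    triangle inequality the absolute values grow no faster than the Fibonacci bound. *)
Lemma norm_dual_le i k :
  (`|dual i (i + k.+3)| <= (fibn (i + k))%:Z)%R.
Proof.
suff: (`|dual i (i + k.+3)| <= (fibn (i + k))%:Z)%R /\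
  (`|dual i (i + k.+4)| <= (fibn (i + k.+1))%:Z)%R by case.
elim: k => [|k [h1 h2]].
  rewrite !dualD addn0 addn1; have := leq_fibn (leqnSn i).
  by move: (fibn i) (fibn i.+1) => p q; rewrite /=; lia.
split=> //; have := antifib_dual i (i + k.+3).
rewrite -!addnS (_ : i + k.+2 = (i + k).+2) 1?fibn_rec; last by lia.
by move: h1 h2; rewrite -!addnS => h1 h2; lia.
Qed.

(** Dual feasibility, with equality at k = i, i+1, i+2. For k < i the left side is at most 0. For k
    >= i+3 the bound on [dual] is f(k-3), and f(k) = 2 f(k-2) + f(k-3). *)
Lemma dual_le i k : (dual i k + 2 * (fibn i.+1)%:Z <= (fibn k)%:Z)%R.
Proof.
have [le_ik|lt_ki] := leqP i k; last first.
  rewrite /dual !f_sub_nneg; try lia.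
  rewrite (_ : i.+2 - k = (i - k).+2) ?fibn_rec; last by lia.
  rewrite (_ : i - k = (i - k.+1).+1); last by lia.
  rewrite fibn_rec.
  have := fibn_gt0 (i - k.+1); have := fibn_gt0 (i - k.+1).+1.
  have := fibn_gt0 k; have := fibn_gt0 i; have := leq_fibn (leqnSn i).
  move: (fibn _) => p *; nia.
rewrite -(subnKC le_ik); move: (k - i) => {le_ik}k.
case: k => [|[|[|k]]].
- by rewrite dualD addn0 /=; lia.
- by rewrite dualD addn1 /=; lia.
- by rewrite dualD addn2 fibn_rec /=; lia.
have := norm_dual_le i k; have := @leq_fibn i.+1 (i + k.+1).
rewrite !addnS fibn_rec (fibn_rec (i + k)); lia.
Qed.

Lemma costZ js : Posz (cost js) = (\sum_(k <- js) (fibn k)%:Z)%R.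
Proof. by rewrite -[LHS]natz /cost natr_sum; apply: eq_bigr => i _; rewrite natz. Qed.

(** Weak duality: [dual_le] is summed over [js] and is an equality on the window. The sums of [dual]
    agree because the values do, so each additional term costs at least c = 2 f(i+1). *)
Lemma cost_lower_bound s x js : windowed s x ->
  value js = value (window x) -> s < size js ->
  cost (window x) + 2 * fibn (level x).+1 <= cost js.
Proof.
move=> wx e lt_s; pose i := level x; pose c := ((fibn i.+1)%:Z * 2)%R.
have le_js : (\sum_(k <- js) dual i k + c * (size js)%:Z <= (cost js)%:Z)%R.
  have -> : (c * (size js)%:Z = \sum_(k <- js) c)%R.
    by rewrite big_const_seq count_predT iter_addr_0 -mulr_natr natz.
  rewrite costZ -big_split; apply: ler_sum => k _ /=.
  by have := dual_le i k; rewrite mulrC.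
have eq_x : (\sum_(k <- js) dual i k + c * s%:Z = (cost (window x))%:Z)%R.
  rewrite (sum_antifib (antifib_dual i) e) /i /c /i.
  case: x wx {e i c le_js} => [[[i A] B] C] /andP[_ /eqP<-].
  rewrite costZ !sum_window; change (level _) with i.
  have := dualD i 0; have := dualD i 1; have := dualD i 2.
  rewrite addn0 addn1 addn2 (fibn_rec i); move: (fibn i) (fibn i.+1) => p q.
  rewrite /= => -> -> ->.
  by rewrite !PoszD; ring.
have : (c * s.+1%:Z <= c * (size js)%:Z)%R by rewrite ler_wpM2l ?lez_nat.
rewrite -lez_nat; change (level x) with i; move: le_js eq_x.
by rewrite /c; move: (\sum_(_ <- _) _)%R => S; lia.
Qed.

(** * Exchanges and reduction to windows *)

Lemma value_cat r1 r2 : value (r1 ++ r2) = (value r1 + value r2)%R.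
Proof. by rewrite /value 2!big_cat. Qed.

Lemma value_cons k r : value (k :: r) = (value [:: k] + value r)%R.
Proof. exact: (value_cat [:: k] r). Qed.

Lemma value_cons2 k l r : value [:: k, l & r] = (value [:: k] + value (l :: r))%R.
Proof. exact: value_cons. Qed.

Lemma cost_cat r1 r2 : cost (r1 ++ r2) = cost r1 + cost r2.
Proof. by rewrite /cost big_cat. Qed.

Lemma cost_cons k r : cost (k :: r) = fibn k + cost r.
Proof. by rewrite /cost big_cons. Qed.

Lemma value_perm r1 r2 : perm_eq r1 r2 -> value r1 = value r2.
Proof. by move=> h; rewrite /value !(perm_big _ h). Qed.

Lemma cost_perm r1 r2 : perm_eq r1 r2 -> cost r1 = cost r2.
Proof. exact: perm_big. Qed.

Lemma value_expand k : value [:: k] = (value [:: k.+1] + value [:: k.+2])%R.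
Proof. by rewrite /value !big_seq1; congr pair; rewrite fneg_rec addrC subrK. Qed.

Lemma value_exchange3 k :
  (value [:: k] + value [:: k.+3] = value [:: k.+1] + value [:: k.+1])%R.
Proof. by rewrite (value_expand k) -addrA -value_expand. Qed.

(** Expanding [i] into i+1, i+2 adds 2 f(i+1) to the cost; by induction the closer pair that starts
    at i+2 saves 2 f(i+2), leaving a net saving of 2 f(i). *)
Lemma exchange_odd r i : exists W, [/\ size W = r.+2,
  value W = value [:: i; i + (2 * r).+3] &
  cost W + 2 * fibn i = cost [:: i; i + (2 * r).+3]].
Proof.
elim: r i => [|r IHr] i.
  exists [:: i.+1; i.+1]; rewrite addn3 !value_cons2 value_exchange3; split=> //.
  by rewrite /cost !big_cons big_nil !fibn_rec; lia.
have [W [sW vW cW]] := IHr i.+2; exists (i.+1 :: W).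
rewrite (_ : i + _ = i.+2 + (2 * r).+3); last by lia.
split; first by rewrite /= sW.
  rewrite value_cons vW [RHS]value_cons (value_expand i) -addrA; congr (_ + _)%R.
  by rewrite value_cons.
by move: cW; rewrite !cost_cons !fibn_rec; lia.
Qed.

(* Carrying an entry [i.+2] allows the next step to exchange
   [i-1, i+2] for [i, i], which pays for the expansion of [i-2]. *)
Lemma exchange_even r i : exists W, [/\ size W = r.+2,
  value (i.+2 :: W) = value [:: i; i + (2 * r).+4] &
  cost (i.+2 :: W) = cost [:: i; i + (2 * r).+4]].
Proof.
elim: r i => [|r IHr] i.
  exists [:: i.+2; i.+2]; rewrite addn4; split=> //.
    by rewrite !value_cons2 (value_expand i) addrAC value_exchange3 addrA.
  by rewrite /cost !big_cons big_nil !fibn_rec; lia.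
have [W [sW vW cW]] := IHr i.+2; exists (i.+2 :: W).
rewrite (_ : i + _ = i.+2 + (2 * r).+4); last by lia.
split; first by rewrite /= sW.
  rewrite [RHS]value_cons (value_expand i) -[in RHS]addrA -value_cons -vW.
  by rewrite value_cons2 !(value_cons _ W) !addrA value_exchange3.
by move: cW; rewrite !cost_cons !fibn_rec; lia.
Qed.

(** The parity of the distance selects the exchange. Odd distances are here at least 5, so r >= 1 in
    [exchange_odd] and at least three terms result. *)
Lemma exchange_far i j : i.+4 <= j -> exists W, [/\ 2 < size W,
  value W = value [:: i; j] & cost W <= cost [:: i; j]].
Proof.
move=> le_ij; have e := odd_double_half (j - i.+3).
case: (odd (j - i.+3)) e => e.
  have [W [sW vW cW]] := exchange_even (j - i.+3)./2 i.
  exists (i.+2 :: W); rewrite vW cW /= sW.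
  by rewrite (_ : i + _ = j); last by lia.
have [W [sW vW cW]] := exchange_odd (j - i.+3)./2 i.
have eij : i + (2 * (j - i.+3)./2).+3 = j by lia.
rewrite eij in vW cW.
by exists W; rewrite vW -cW sW leq_addr; split=> //; lia.
Qed.

Lemma windowP i (js : seq nat) : i \in js -> (forall k, k \in js -> i <= k <= i.+2) ->
  exists2 x, windowed (size js) x & perm_eq js (window x).
Proof.
move=> i_js h; pose m k := count_mem k js.
have p : perm_eq js (window (i, m i, m i.+1, m i.+2)).
  apply/allP => k _ /=; rewrite !count_cat !count_nseq /= -/(m k).
  have ltF n l : n < l -> (l == n) = false by move/gtn_eqF.
  have [->|n0] := eqVneq k i; first by rewrite ?(ltF i i.+2) // ?(ltF i i.+1) // ?(ltF i.+1 i.+2) //= mul1n !addn0.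
  have [->|n1] := eqVneq k i.+1; first by rewrite ?(ltF i i.+2) // ?(ltF i i.+1) // ?(ltF i.+1 i.+2) //= mul1n !addn0.
  have [->|n2] := eqVneq k i.+2; first by rewrite mul1n.
  by rewrite /m (count_memPn _) //; apply/negP => /h; lia.
exists (i, m i, m i.+1, m i.+2) => //.
rewrite /= -has_count has_pred1 i_js (perm_size p) /= !size_cat !size_nseq.
by rewrite addnA eqxx.
Qed.

(* By [exchange_far], a multiset of maximal size has no two entries at distance
   at least 4; exchanging entries at distance 3 lowers the cost. *)
Lemma window_of_maximal d js : js != [::] -> cost js <= d ->
  (forall js', value js' = value js -> cost js' <= d -> size js' <= size js) ->
  exists x, [/\ windowed (size js) x, value (window x) = value js &
    cost (window x) <= d].
Proof.
have [n] := ubnP (cost js); elim: n js => // n IHn js lt_n js0 le_d max_js.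
have [i i_js i_min] : exists2 i : nat, i \in js & forall k : nat, k \in js -> i <= k.
  have [|i] := @ex_minnP (fun k => k \in js).
    by case: js js0 {lt_n le_d max_js} => // k js _; exists k; apply: mem_head.
  by exists i.
have [/allP h|/allPn far] := boolP (all (fun k => k <= i.+2) js).
  have [|x wx p] := @windowP i js i_js.
    by move=> k kj; rewrite i_min //; apply: h.
  by exists x; rewrite -(value_perm p) -(cost_perm p).
have {far}[j j_js lt_ij] : exists2 j : nat, j \in js & i.+2 < j.
  by case: far => j j_js; rewrite -ltnNge; exists j.
have [r p] : exists r : seq nat, perm_eq js ([:: i; j] ++ r).
  exists (rem j (rem i js)); apply: perm_trans (perm_to_rem i_js) _.
  rewrite perm_cons; apply: perm_to_rem.
  have := perm_mem (perm_to_rem i_js) j; rewrite j_js in_cons.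
  by case: eqP => [ji|_ /= <-] //; move: lt_ij; rewrite ji; lia.
have cE := cost_perm p; have vE := value_perm p; have sE := perm_size p.
rewrite cost_cat in cE; rewrite value_cat in vE.
rewrite size_cat in sE.
move: lt_ij; rewrite leq_eqVlt => /orP[/eqP e|lt_ij].
  have [W [sW vW cW]] := exchange_odd 0 i; rewrite addn3 e in vW cW.
  have i_gt0 := fibn_gt0 i.
  have sWr : size (W ++ r) = size js by rewrite size_cat sW sE.
  have vWr : value (W ++ r) = value js by rewrite value_cat vW vE.
  rewrite -sWr -vWr; apply: IHn.
  - by rewrite cost_cat; lia.
  - by rewrite -size_eq0 sWr sE.
  - by rewrite cost_cat; lia.
  - by move=> js'; rewrite vWr sWr; apply: max_js.
have [W [sW vW cW]] := exchange_far lt_ij.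
have := max_js (W ++ r); rewrite value_cat vW vE => /(_ erefl).
by rewrite cost_cat size_cat sE /=; lia.
Qed.

(** * Maximal representations as windows in a cost range *)

(** Expanding one least entry attains the bound of [cost_lower_bound]. *)
Lemma window_expand s x : windowed s x -> exists js, [/\ size js = s.+1,
  value js = value (window x) &
  cost js = cost (window x) + 2 * fibn (level x).+1].
Proof.
case: x => [[[i [//|A]] B] C] wx; have sx := size_window wx.
pose r := window (i, A, B, C).
have wE : window (i, A.+1, B, C) = i :: r by [].
exists (i.+1 :: i.+2 :: r); rewrite wE; split.
- by rewrite -sx.
- by rewrite value_cons2 (value_cons i.+2) (value_cons i) addrA -value_expand.
- by rewrite !cost_cons fibn_rec; change (level _) with i; lia.
Qed.

Lemma maximal_repP d p s : 0 < s -> maximal_rep d p s <->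
  exists x, [/\ windowed s x, p = value (window x) &
    cost (window x) <= d < cost (window x) + 2 * fibn (level x).+1].
Proof.
move=> s_gt0; split=> [[/solvableP[js [sj pj cj]] max_s]|[x [wx -> /andP[cx dx]]]].
  have [||js' vjs' cjs'|x [wx vx cx]] := @window_of_maximal d js.
  - by rewrite -size_eq0 sj -lt0n.
  - by [].
  - by rewrite sj max_s //; apply/solvableP; exists js'; rewrite vjs'.
  rewrite sj in wx; exists x; split=> //; first by rewrite vx.
  rewrite cx ltnNge; apply/negP => le_d.
  have [js' [sj' vj' cj']] := window_expand wx.
  suff /max_s : solvable d p s.+1 by rewrite ltnn.
  by apply/solvableP; exists js'; rewrite vj' vx cj'.
split=> [|s' /solvableP[js [<- vj cj]]].
  by apply/solvableP; exists (window x); rewrite (size_window wx).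
rewrite leqNgt; apply/negP => /(cost_lower_bound wx (esym vj)); lia.
Qed.

(** * The cost-raising injection and its orbits *)

(* On costs, [raise] agrees with the expansion of one entry [i] into [i+1, i+2]
   but keeps the number of terms: it replaces [i] by [i+3], the cost of which is
   [f(i+1) + f(i+2)], and renormalises by [i, i+3 -> i+2, i+2] if another [i]
   is left, which does not change the cost. *)
Definition raise (x : nat * nat * nat * nat) : nat * nat * nat * nat :=
  let: (i, A, B, C) := x in
  match A, B, C with
  | A'.+3, _, _ => (i, A'.+1, B, C.+2)
  | 2, 0, _ => (i.+2, C.+2, 0, 0)
  | 2, _, _ => (i.+1, B, C.+2, 0)
  | _, 0, 0 => (i.+3, 1, 0, 0)
  | _, 0, _ => (i.+2, C, 1, 0)
  | _, _, _ => (i.+1, B, C, 1)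
  end.

(** The starting points of the [raise]-orbits; by [is_start_cost] these are the windows of cost at
    most s+1. *)
Definition is_start (x : nat * nat * nat * nat) : bool :=
  let: (i, A, B, C) := x in
  [|| (i == 0) && (C < 2), [&& i == 1, C == 0 & B < 2] | x == (2, 1, 0, 0)].

Lemma raise_windowed s x : windowed s x -> windowed s (raise x).
Proof.
case: x => [[[i [|[|[|A]]]] [|B]] [|C]] //= /eqP <-; apply/eqP; lia.
Qed.

Lemma cost_raise s x : windowed s x ->
  cost (window (raise x)) = cost (window x) + 2 * fibn (level x).+1.
Proof.
case: x => [[[i A] B] C] /andP[A_gt0 _]; change (level _) with i.
case: A B C A_gt0 => [|[|[|A]]] [|B] [|C] // _;
  by rewrite [raise _]/= !cost_window !fibn_rec; lia.
Qed.

(** The branches have disjoint images. The last multiplicity is at least 2 in the first branch, 1 in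
    the final one and 0 in the others; those differ in the middle multiplicity (at least 2, 1 or 0)
    and, when it is 0, in whether the first is 1. *)
Lemma raise_inj s x y : windowed s x -> windowed s y ->
  raise x = raise y -> x = y.
Proof.
case: x y => [[[i A] B] C] [[[j A'] B'] C'] /andP[A_gt0 _] /andP[A'_gt0 _].
case: A B C A_gt0 => [|[|[|A]]] [|B] [|C] // _;
case: A' B' C' A'_gt0 => [|[|[|A']]] [|B'] [|C'] // _;
  rewrite /raise => -[] *; by subst.
Qed.

(** The multiplicities identify the branch and hence the preimage; the starts are exactly the
    windows whose preimage would have negative level. *)
Lemma raise_surj s x : windowed s x -> ~~ is_start x ->
  exists2 y, windowed s y & raise y = x.
Proof.
case: x => [[[i A] B] C] wx nx.
suff [y [yA <-]] : exists y, windowed s y /\ raise y = (i, A, B, C) by exists y.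
move: wx => /andP[A_gt0 /eqP es].
case: C es nx => [|[|C]] es nx.
- case: B es nx => [|[|B]] es nx.
  + case: A A_gt0 es nx => [|[|A]] // _ es nx.
      case: i nx => [|[|[|i]]] // _.
      by exists (i, 1, 0, 0); rewrite /= -es.
    case: i nx => [|[|i]] // _.
    by exists (i, 2, 0, A); split=> //=; apply/eqP; lia.
  + case: i nx => [|[|i]] // _.
    case: A A_gt0 es => // A _ es.
    by exists (i, 1, 0, A.+1); split=> //=; apply/eqP; lia.
  + case: i nx => [|i] // _; case: A A_gt0 es => // A _ es.
    by exists (i, 2, A.+1, B); split=> //=; apply/eqP; lia.
- case: i nx => [|i] // _; case: A A_gt0 es => // A _ es.
  by exists (i, 1, A.+1, B); split=> //=; apply/eqP; lia.
case: A A_gt0 es {nx} => // A _ es.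
by exists (i, A.+3, B, C); split=> //=; apply/eqP; lia.
Qed.

(** The blocks have s, s-1 and 2 elements. For s = 1 the quadruple (1, 0, 1, 0) is not [windowed];
    its only entry 2 is encoded as (2, 1, 0, 0). *)
Definition starts (s : nat) : seq (nat * nat * nat * nat) :=
  [seq (0, s - B, B, 0) | B <- iota 0 s] ++
  [seq (0, s.-1 - B, B, 1) | B <- iota 0 s.-1] ++
  (if s == 1 then [:: (1, 1, 0, 0); (2, 1, 0, 0)]
   else [:: (1, s, 0, 0); (1, s.-1, 1, 0)]).

Lemma size_starts s : 0 < s -> size (starts s) = 2 * s + 1.
Proof.
move=> s_gt0; rewrite !size_cat !size_map !size_iota.
by case: ifP => _ /=; lia.
Qed.

Lemma uniq_starts s : uniq (starts s).
Proof.
rewrite !cat_uniq !map_inj_uniq ?iota_uniq => [|B B' []|B B' []] //=.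
apply/and3P; split.
- rewrite has_cat; apply/norP; split.
    by apply/hasPn => _ /mapP[B _ ->]; apply/mapP => -[].
  by case: ifP => _ /=; rewrite !orbF; apply/norP; split; apply/mapP => -[].
- by case: ifP => _ /=; rewrite !orbF; apply/norP; split; apply/mapP => -[].
- by case: ifP => _; rewrite cons_uniq inE andbT; apply/eqP=> -[].
Qed.

Lemma mem_starts s x : 0 < s -> (x \in starts s) = windowed s x && is_start x.
Proof.
move=> s_gt0; case: x => [[[i A] B] C]; rewrite !mem_cat.
apply/idP/idP.
  case/or3P.
  - by case/mapP=> b; rewrite mem_iota => lb [-> -> -> ->]; rewrite /windowed /is_start !xpair_eqE; lia.
  - by case/mapP=> b; rewrite mem_iota => lb [-> -> -> ->]; rewrite /windowed /is_start !xpair_eqE; lia.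
  by case: eqP => s1; rewrite !inE => /orP[] /eqP[-> -> -> ->]; rewrite /windowed /is_start !xpair_eqE; lia.
case/andP=> /andP[A_gt0 /eqP es] /or3P[/andP[/eqP-> lC]||/eqP[-> eA eB eC]].
- case: C lC es => [|[|C]] // _ es.
    apply/orP; left; apply/mapP; exists B; first by rewrite mem_iota; lia.
    by congr (_, _, _, _); lia.
  apply/or3P; apply: Or32; apply/mapP; exists B; first by rewrite mem_iota; lia.
  by congr (_, _, _, _); lia.
- case/and3P=> /eqP-> /eqP eC lB; apply/or3P; apply: Or33.
  case: eqP => s1.
    by rewrite !inE; apply/orP; left; apply/eqP; congr (_, _, _, _); lia.
  by case: B lB es => [|[|B]] // _ es; rewrite !inE; apply/orP; [left|right];
    apply/eqP; congr (_, _, _, _); lia.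
- by apply/or3P; apply: Or33; rewrite -es eA eB eC.
Qed.

(** The excess of the cost over s is C, B + 2C, A + 2B + 4C at levels 0, 1, 2. From level 3 on every
    term costs at least 3, and 3s > s+1. *)
Lemma is_start_cost s x : windowed s x ->
  is_start x = (cost (window x) <= s.+1).
Proof.
case: x => [[[i A] B] C] /andP[A_gt0 /eqP<-]; rewrite cost_window.
case: i => [|[|[|i]]].
- by rewrite /is_start !xpair_eqE /=; lia.
- by rewrite /is_start !xpair_eqE /=; lia.
- by rewrite /is_start !xpair_eqE /=; lia.
have -> : is_start (i.+3, A, B, C) = false by [].
have le3 k n : i.+3 <= k -> 3 * n <= fibn k * n.
  by move=> le_ik; rewrite leq_mul2r (@leq_fibn 3) ?orbT // (leq_trans _ le_ik).
have := le3 _ A (leqnn _); have := le3 _ B (leqnSn _).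
have := le3 _ C (ltnW (leqnSn _)).
by move: (fibn i.+3) (fibn i.+4) (fibn i.+4.+1) => p q r; lia.
Qed.

Lemma start_gap s x : windowed s x -> is_start x ->
  s.+1 < cost (window x) + 2 * fibn (level x).+1.
Proof.
case: x => [[[i A] B] C] /andP[_ /eqP<-]; rewrite cost_window.
by case/or3P=> [/andP[/eqP-> _]|/and3P[/eqP-> _ _]|/eqP[-> -> -> ->]]; rewrite /=; lia.
Qed.

(** Passage from the bound d-1 to d along an orbit; one move is enough because every [raise]
    increases the cost. *)
Definition step d (x : nat * nat * nat * nat) :=
  if cost (window (raise x)) <= d then raise x else x.

(* Every [raise]-orbit has exactly one member with
   [cost (window x) <= d < cost (window (raise x))]; by induction on [d]. *)
Lemma front_windows s d : 0 < s < d -> exists L, [/\ uniq L, size L = 2 * s + 1 &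
  forall x, (x \in L) =
    windowed s x && (cost (window x) <= d < cost (window x) + 2 * fibn (level x).+1)].
Proof.
case/andP=> s_gt0 /subnKC <-; elim: (d - s.+1) => [|n [L [uL sL mL]]].
  rewrite addn0; exists (starts s).
  split=> [||x]; rewrite ?uniq_starts ?size_starts ?mem_starts //.
  have [wx|//] := boolP (windowed s x).
  rewrite 2!andTb andb_idr -(is_start_cost wx) //; exact: start_gap.
rewrite (addnS s.+1); move: (s.+1 + n) (leq_addr n s.+1) mL => e lt_e mL {d n}.
have inL x : x \in L ->
    windowed s x /\ cost (window x) <= e < cost (window (raise x)).
  by rewrite mL => /andP[wx]; rewrite (cost_raise wx).
exists (map (step e.+1) L); split.
- rewrite map_inj_in_uniq // => x y /inL[wx /andP[x1 x2]] /inL[wy /andP[y1 y2]].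
  rewrite /step; case: ifP => hx; case: ifP => hy // E.
  + exact: raise_inj wx wy E.
  + by move: y1 x2; rewrite -E; lia.
  + by move: x1 y2; rewrite E; lia.
- by rewrite size_map.
move=> x; apply/mapP/idP => [[y /inL[wy /andP[y1 y2]] ->]|].
  have wr := raise_windowed wy.
  rewrite /step; case: ifP => hy.
    rewrite wr hy 2!andTb.
    by have := fibn_gt0 (level (raise y)).+1; lia.
  by rewrite wy -(cost_raise wy) leqW //= ltnNge hy.
case/andP=> wx /andP[x1 x2].
(* Either [x] already satisfied the condition for [e] and stays fixed, or its cost is e+1 > s+1;
   then it is no start and its preimage under [raise] is the member that moves. *)
have [le_e|lt_x] := leqP (cost (window x)) e.
  exists x; first by rewrite mL wx le_e ltnW.
  by rewrite /step (cost_raise wx) leqNgt x2.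
have [|y wy yx] := raise_surj wx; first by rewrite (is_start_cost wx); lia.
have cy := cost_raise wy; rewrite yx in cy; exists y.
  by rewrite mL wy -cy lt_x andbT; have := fibn_gt0 (level y).+1; lia.
by rewrite /step yx x1.
Qed.

(** * The boundary case s = d and the final count *)

Lemma size_le_cost js : size js <= cost js.
Proof.
elim: js => // k js IH; rewrite cost_cons /=; have := fibn_gt0 k; lia.
Qed.

(** Each entry costs at least 1, so here each costs exactly 1 and is 0 or 1, contributing (1, 0) or
    (0, 1); [a] counts the zeros. *)
Lemma value_of_units js : cost js <= size js ->
  exists2 a, a <= size js & value js = (a%:Z, (size js - a)%:Z)%R.
Proof.
elim: js => [|k js IH]; first by exists 0 => //; rewrite /value !big_nil.
rewrite cost_cons /= => h.
have := fibn_gt0 k; have := size_le_cost js => h1 h2.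
have /fibn_eq1 : fibn k = 1 by lia.
have [|a la va] := IH; first lia.
rewrite value_cons va; case: k {h h2} => [|[|k]] // _.
  by exists a.+1 => //; rewrite /value !big_seq1; congr pair; rewrite /=; lia.
exists a; first by lia.
by rewrite /value !big_seq1; congr pair; rewrite /=; lia.
Qed.

Lemma value_nseq a b :
  value (nseq a 0 ++ nseq b 1) = (a%:Z, b%:Z)%R.
Proof.
rewrite /value; congr pair; rewrite big_cat !sum_nseq /=; lia.
Qed.

Theorem mainTheorem1 (d s : nat) :
  exists l : seq (int * int),
    [/\ uniq l,
        (forall p : int * int, p \in l <-> maximal_rep d p s)
      & size l = chi_value d s].
Proof.
rewrite /chi_value; have [lt_sd|lt_ds|e] := ltngtP s d; last first.
- subst s; exists [seq (a%:Z, (d - a)%:Z)%R | a <- iota 0 d.+1]; split.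
  + by rewrite map_inj_uniq ?iota_uniq // => a b [].
  + move=> p; split=> [/mapP[a]|[/solvableP[js [sj -> cj]] _]].
      rewrite mem_iota => la ->; split=> [|s' /solvableP[js [<- _ cj]]].
        apply/solvableP; exists (nseq a 0 ++ nseq (d - a) 1); split.
        * by rewrite size_cat !size_nseq; lia.
        * by rewrite value_nseq.
        * by rewrite /cost big_cat !big_nseq !iter_addn_0 /=; lia.
      by apply: leq_trans (size_le_cost js) cj.
    have [|a la ->] := @value_of_units js; first by rewrite sj.
    by rewrite sj in la *; apply/mapP; exists a; rewrite ?mem_iota.
  + by rewrite size_map size_iota.
- exists [::]; split=> // p; split=> // -[/solvableP[js [sj _ cj]] _].
  by have := size_le_cost js; lia.
(* Windows are nonempty, so s = 0 is separate: only the origin has a longest representation with no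
   terms. *)
case: s lt_sd => [|s] lt_sd.
  exists [:: value [::]]; split=> // p; rewrite inE; split=> [/eqP->|].
    split=> [|s' /solvableP[js [<- /esym e _]]].
      by apply/solvableP; exists [::]; rewrite /cost big_nil.
    by case: js e => // k js /value_neq0; case.
  by case=> /solvableP[js [/eqP/nilP -> -> _]] _.
have [L [uL sL mL]] := @front_windows s.+1 d lt_sd.
exists [seq value (window x) | x <- L]; split.
- rewrite map_inj_in_uniq // => x y.
  rewrite !mL => /andP[wx _] /andP[wy _]; exact: value_window_inj wx wy.
- move=> p; rewrite maximal_repP //; split=> [/mapP[x]|[x [wx -> cx]]].
    by rewrite mL => /andP[wx cx] ->; exists x.
  by apply: map_f; rewrite mL wx.
- by rewrite size_map.
Qed.
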